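(* Let $m$ be a positive integer with $m\not\equiv 0\pmod 3$, let $n=2m$, and let $\delta\in\mathbb{F}_{2^n}$. Let $F(X)=(X^{2^m}+X+\delta)^{3\cdot 2^{m-2}+2^{2m-2}}+X$, viewed as a function $\mathbb{F}_{2^n}\to\mathbb{F}_{2^n}$. Then $F$ is P$c$N for every $c\in\mathbb{F}_{2^m}\setminus\{1\}$.
   Context: For $F:\mathbb{F}_q\to\mathbb{F}_q$ and $a,b,c\in\mathbb{F}_q$, let ${}_c\Delta_F(a,b)$ be the number of $X\in\mathbb{F}_q$ with $F(X+a)-cF(X)=b$. The $c$-differential uniformity of $F$ is ${}_c\Delta_F=\max\{{}_c\Delta_F(a,b): a,b\in\mathbb{F}_q,\ a\neq 0 \text{ if } c=1\}$. $F$ is perfect $c$-nonlinear (P$c$N) if ${}_c\Delta_F=1$. *)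

(* Defs.v *)
From HB Require Import structures.
From mathcomp Require Export all_boot all_order all_algebra.

Set Implicit Arguments.
Unset Strict Implicit.
Unset Printing Implicit Defensive.

Import GRing.Theory.
Local Open Scope ring_scope.

Definition cDelta (L : finFieldType) (c : L) (F : L -> L) (a b : L) : nat :=
  #|[set x : L | F (x + a) - c * F x == b]|.

Definition cDiffUniformity (L : finFieldType) (c : L) (F : L -> L) : nat :=
  (\max_(ab : L * L | (c == 1%R) ==> (ab.1 != 0%R)) cDelta c F ab.1 ab.2)%N.

Definition PcN (L : finFieldType) (c : L) (F : L -> L) : Prop :=
  cDiffUniformity c F = 1%N.

Definition is_subfield (L : finFieldType) (K : {set L}) : Prop :=
  GRing.divring_closed (mem K).

(* The subtraction m - 2 is truncated, which matters only for m = 1: there the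
   exponent is 4, whereas reading 2 ^ (m - 2) = 2 ^ (-1) as the inverse of 2
   modulo 2 ^ (2 * m) - 1 = 3 gives 3 * 2 + 1 = 7.  Both are positive and equal
   to 1 modulo 3, so they define the same power map on the field of order 4. *)
Definition Fmap (L : finFieldType) (m : nat) (delta : L) (x : L) : L :=
  (x ^+ (2 ^ m) + x + delta) ^+ (3 * 2 ^ (m - 2) + 2 ^ (2 * m - 2)) + x.

(* Main.v *)
Require Import Defs.
From mathcomp Require Import all_boot all_order all_algebra.
From mathcomp Require Import finfield.
From mathcomp Require Import ring.

Set Implicit Arguments.
Unset Strict Implicit.
Unset Printing Implicit Defensive.

Import GRing.Theory.
Local Open Scope ring_scope.

(** Write q = 2^m, T x = x + x^q and N x = x * x^q, and let d be the exponent
    occurring in F.  Since 4 d = 3 q + 1 modulo q^2 - 1, one gets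
    T (z^d)^4 = N z * (T z)^2.  If y = x + e satisfies
    F (y + a) - c F y = F (x + a) - c F x, then applying x |-> (T x)^4, which is
    additive and semilinear over the field of order q, yields
    (1 + c)^4 (w^4 + t^2 w^2 + t^3 w) = 0 with w = T e and t = T delta.
    A nonzero w would make w / t a root of s^3 + s + 1 in the field of order q,
    hence an element of order 7, which is impossible when 3 does not divide m.
    So w = 0, and the original equation reduces to (1 + c) e = 0. *)

(** Multiplication by a nonzero [c] permutes [K :\ 0]; comparing the products over this set before
    and after gives [c ^+ (#|K| - 1) = 1]. *)
Lemma subfield_expf_card (L : finFieldType) (K : {set L}) (c : L) :
  is_subfield K -> c \in K -> c ^+ #|K| = c.
Proof.
case=> K1 KB KV cK.
have K0 : 0 \in K by rewrite -(subrr 1); apply: KB.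
have cardK : #|K| = #|K :\ 0|.+1 by rewrite (cardsD1 0) K0.
have [-> | c0] := eqVneq c 0; first by rewrite cardK expr0n.
have KM x : x \in K -> c * x \in K.
  move=> xK; have xVK : x^-1 \in K by rewrite -[x^-1]mul1r; apply: KV.
  by rewrite -[x]invrK; apply: KV.
have inj_c : injective ( *%R c) by apply: mulfI.
have imK : [set c * x | x in K :\ 0] = K :\ 0.
  apply/eqP; rewrite eqEcard card_imset // leqnn andbT.
  apply/subsetP=> _ /imsetP[x /setD1P[x0 xK] ->].
  by rewrite !inE mulf_neq0 // KM.
have P0 : \prod_(x in K :\ 0) x != 0.
  by apply/prodf_neq0 => x /setD1P[].
have : \prod_(x in K :\ 0) x = c ^+ #|K :\ 0| * \prod_(x in K :\ 0) x.
  rewrite -{1}imK big_imset /=; last by move=> ? ? _ _; apply: inj_c.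
  by rewrite big_split /= prodr_const.
rewrite -{1}[\prod_(x in _) x]mul1r => /(mulIf P0) e1.
by rewrite cardK exprS -e1 mulr1.
Qed.

Section CharTwo.

Variable L : finFieldType.
Hypothesis charL2 : 2%N \in [pchar L].

Lemma exprD_pow2 (k : nat) (x y : L) :
  (x + y) ^+ (2 ^ k) = x ^+ (2 ^ k) + y ^+ (2 ^ k).
Proof. by apply: exprDn_pchar; rewrite pnatX pnatE //= charL2. Qed.

Lemma expr2D (x y : L) : (x + y) ^+ 2 = x ^+ 2 + y ^+ 2.
Proof. exact: (exprD_pow2 1). Qed.

Lemma expr4D (x y : L) : (x + y) ^+ 4 = x ^+ 4 + y ^+ 4.
Proof. exact: (exprD_pow2 2). Qed.

(** A root satisfies [s ^+ 8 = s], so the exponent [2 ^ m] reduces to [2 ^ (m %% 3)], that is, to 2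
    or 4. *)
Lemma cubic_no_root (m : nat) (s : L) :
  (m <> 0 %[mod 3])%N -> s ^+ (2 ^ m) = s -> s ^+ 3 + s + 1 != 0.
Proof.
move=> hm3 sm; apply/eqP=> s3E.
have s3 : s ^+ 3 = s + 1.
  by apply/eqP; rewrite -subr_eq0 (oppr_pchar2 charL2) addrA s3E.
have s4 : s ^+ 4 = s ^+ 2 + s by rewrite exprSr s3; ring.
have s8 : s ^+ 8 = s.
  rewrite (exprM s 4 2) s4 expr2D -exprM s4 addrAC.
  by rewrite (addrr_pchar2 charL2) add0r.
have s8k k : s ^+ (8 ^ k) = s.
  by elim: k => // k IHk; rewrite expnS exprM s8.
have : s ^+ (2 ^ (m %% 3)) = s.
  have powE : (2 ^ m = 8 ^ (m %/ 3) * 2 ^ (m %% 3))%N.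
    by rewrite {1}(divn_eq m 3) expnD (mulnC (m %/ 3)%N) (expnM 2 3).
  by rewrite -[RHS]sm powE exprM s8k.
have : (m %% 3 < 3)%N by rewrite ltn_mod.
case E : (m %% 3)%N => [|[|[|r]]] //= _.
  by rewrite expn1 => s2; move: s3E; rewrite exprS s2 -expr2 s2
    (addrr_pchar2 charL2) add0r => /eqP; rewrite oner_eq0.
(* Residue 2: [s ^+ 4 = s] together with [s4] leaves [s ^+ 2 = 0]. *)
rewrite s4 => /eqP; rewrite -subr_eq0 addrK expf_eq0 /= => /eqP s0.
by move: s3E; rewrite s0 expr0n /= !add0r => /eqP; rewrite oner_eq0.
Qed.

Variable m : nat.
Hypothesis m_gt0 : (0 < m)%N.
Hypothesis cardL : #|L| = (2 ^ (2 * m))%N.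

Local Notation q := (2 ^ m)%N.
Local Notation d := (3 * 2 ^ (m - 2) + 2 ^ (2 * m - 2))%N.
Local Notation Tr := (fun x : L => x + x ^+ q).

Lemma conjK (x : L) : (x ^+ q) ^+ q = x.
Proof. by rewrite -exprM -expnD addnn -mul2n -cardL expf_card. Qed.

Lemma Tr_conj (x : L) : Tr x ^+ q = Tr x.
Proof. by rewrite /= exprD_pow2 conjK addrC. Qed.

Lemma TrD (x y : L) : Tr (x + y) = Tr x + Tr y.
Proof. by rewrite /= exprD_pow2 addrACA. Qed.

Lemma TrZ (c x : L) : c ^+ q = c -> Tr (c * x) = c * Tr x.
Proof. by move=> cq; rewrite /= exprMn cq mulrDr. Qed.

Lemma Tr_fixed (w : L) : w ^+ q = w -> Tr w = 0.
Proof. by move=> /= ->; rewrite (addrr_pchar2 charL2). Qed.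

Lemma exprd4 (z : L) : (z ^+ d) ^+ 4 = (z ^+ q) ^+ 3 * z.
Proof.
rewrite -exprM; case: m m_gt0 cardL => [|[|k]] // _ cL.
  (* For [m = 1] truncation makes the exponent 4; since [#|L| = 4], both sides equal [z]. *)
  by rewrite -exprM -exprSr (exprM z 4 4) -[4%N in LHS]cL !expf_card
     (exprD z 4 3) -[4%N in RHS]cL expf_card -exprS -[4%N in RHS]cL expf_card.
have -> : ((3 * 2 ^ (k.+2 - 2) + 2 ^ (2 * k.+2 - 2)) * 4
           = 2 ^ k.+2 * 3 + 2 ^ (2 * k.+2))%N.
  rewrite -[k.+2]addn2 addnK mulnDr -addnBA // !expnD; ring.
by rewrite exprD -cL expf_card exprM.
Qed.

(** With [z'] the conjugate of [z], the left side is [z'^3 z + z^3 z' = z z' (z^2 + z'^2)], and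
    squaring is additive. *)
Lemma Tr_exprd (z : L) : Tr (z ^+ d) ^+ 4 = z * z ^+ q * Tr z ^+ 2.
Proof.
rewrite /= expr4D (exprAC (z ^+ d)) !exprd4 exprMn (exprAC (z ^+ q)) conjK.
rewrite expr2D; ring.
Qed.

(** Since [Tr w = 0], the shift preserves the trace of [z], while its norm grows by
    [w ^+ 2 + Tr z * w]. *)
Lemma Tr_exprd_shift (z w : L) : w ^+ q = w ->
  Tr ((z + w) ^+ d) ^+ 4
  = Tr (z ^+ d) ^+ 4 + Tr z ^+ 2 * (w ^+ 2 + Tr z * w).
Proof.
by move=> wq; rewrite !Tr_exprd TrD (Tr_fixed wq) addr0 exprD_pow2 wq; ring.
Qed.

Lemma quartic_only_zero (t w : L) : (m <> 0 %[mod 3])%N ->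
  t ^+ q = t -> w ^+ q = w -> w ^+ 4 + t ^+ 2 * (w ^+ 2 + t * w) = 0 -> w = 0.
Proof.
move=> hm3 tq wq E; apply/eqP; apply: contraT => w0.
have [t0 | t0] := eqVneq t 0.
  move/eqP: E; rewrite t0 expr0n /= mul0r addr0 expf_eq0 /=.
  by rewrite (negPf w0).
have sq : (w / t) ^+ q = w / t by rewrite exprMn exprVn wq tq.
case/negP: (cubic_no_root hm3 sq); apply/eqP.
(* The quartic is [w * t ^+ 3] times the cubic evaluated at [w / t]. *)
have wt0 : w * t ^+ 3 != 0 by rewrite mulf_neq0 ?expf_neq0.
apply: (mulfI wt0); rewrite mulr0 -[RHS]E; field.
by [].
Qed.

Lemma Fmap_cdiff_inj (delta a c : L) : (m <> 0 %[mod 3])%N ->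
  c ^+ q = c -> c != 1 ->
  injective (fun x => Fmap m delta (x + a) - c * Fmap m delta x).
Proof.
move=> hm3 cq c1 x y /= E.
have c1' : 1 + c != 0 by rewrite -(oppr_pchar2 charL2 c) subr_eq0 eq_sym.
have [e yE] : exists e, y = x + e by exists (y - x); rewrite addrC subrK.
move: E; rewrite {y}yE /Fmap !(oppr_pchar2 charL2).
set z0 := x ^+ q + x + delta.
set z1 := (x + a) ^+ q + (x + a) + delta.
have wq := Tr_conj e; set w := Tr e in wq.
have -> : (x + e) ^+ q + (x + e) + delta = z0 + w.
  by rewrite /z0 /w exprD_pow2; ring.
have -> : (x + e + a) ^+ q + (x + e + a) + delta = z1 + w.
  by rewrite /z1 /w !exprD_pow2; ring.
(* As [u ^+ q + u] has trace 0, [z0] and [z1] share the trace of [delta], so both shifts contribute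
   the same term. *)
have Trz u : Tr (u ^+ q + u + delta) = Tr delta.
  by rewrite TrD [X in X + _]Tr_fixed ?add0r // addrC Tr_conj.
have Trz0 : Tr z0 = Tr delta by apply: Trz.
have Trz1 : Tr z1 = Tr delta by apply: Trz.
set G1 := z1 ^+ d; set G0 := z0 ^+ d.
set H1 := (z1 + w) ^+ d; set H0 := (z0 + w) ^+ d.
move=> E.
have {}E : G1 + c * G0 = H1 + c * H0 + (1 + c) * e.
  apply: (addIr (x + a + c * x)).
  by transitivity (G1 + (x + a) + c * (G0 + x)); [ring | rewrite E; ring].
have w0 : w = 0.
  apply: (quartic_only_zero hm3 (Tr_conj delta) wq).
  have := congr1 (fun u => Tr u ^+ 4) E.
  (* Being fixed by conjugation, [c] and [1 + c] can be pulled out of the trace. *)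
  have c1q : (1 + c) ^+ q = 1 + c by rewrite exprD_pow2 expr1n cq.
  have Tr4D u v : Tr (u + v) ^+ 4 = Tr u ^+ 4 + Tr v ^+ 4.
    by rewrite TrD expr4D.
  rewrite !Tr4D !(TrZ _ cq) (TrZ _ c1q) -/w !exprMn.
  rewrite /H0 /H1 (Tr_exprd_shift z0 wq) (Tr_exprd_shift z1 wq).
  rewrite Trz0 Trz1 -/G0 -/G1 (expr4D 1 c) expr1n.
  set t := Tr delta; move/eqP; rewrite eq_sym -subr_eq0 => /eqP E4.
  (* The fourth powers of the traces of [G1] and [c * G0] cancel; the two shift terms have total
     coefficient [1 + c ^+ 4 = (1 + c) ^+ 4]. *)
  have : (1 + c) ^+ 4 * (w ^+ 4 + t ^+ 2 * (w ^+ 2 + t * w)) = 0.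
    by rewrite expr4D expr1n -[RHS]E4; ring.
  by move/eqP; rewrite mulf_eq0 expf_eq0 /= (negPf c1') => /eqP.
move: E; rewrite /H1 /H0 w0 !addr0 => /eqP.
rewrite -subr_eq0 opprD addrA subrr sub0r oppr_eq0 mulf_eq0 (negPf c1') /=.
by move=> /eqP ->; rewrite addr0.
Qed.

End CharTwo.

Lemma PcN_of_cdiff_inj (L : finFieldType) (c : L) (F : L -> L) : c != 1 ->
  (forall a, injective (fun x => F (x + a) - c * F x)) -> PcN c F.
Proof.
move=> c1 injF; apply/eqP; rewrite eqn_leq; apply/andP; split.
  apply/bigmax_leqP=> -[a b] _ /=; apply/card_le1_eqP=> x y.
  rewrite !inE => /eqP Ex /eqP Ey; apply: (injF a); by rewrite Ex Ey.
(* For the lower bound, the direction [a = 0] is admissible because [c != 1], and [b] is chosen so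
   that [x = 0] is a solution. *)
pose b := F (0 + 0) - c * F 0.
apply: leq_trans (leq_bigmax_cond (0, b) _); last by rewrite (negPf c1).
by apply/card_gt0P; exists 0; rewrite inE.
Qed.

Theorem theorem3p3 (m n : nat) (L : finFieldType) (K : {set L}) (delta : L)
    (hm : (0 < m)%N) (hm3 : (m <> 0 %[mod 3])%N) (hn : n = (2 * m)%N)
    (hL : #|L| = (2 ^ n)%N)
    (hK : is_subfield K) (hKcard : #|K| = (2 ^ m)%N) :
  forall c : L, c \in K -> c != 1 -> PcN c (Fmap m delta).
Proof.
move=> c cK c1; apply: PcN_of_cdiff_inj => // a.
have charL2 : 2%N \in [pchar L] by apply: card_finPcharP hL _.
apply: Fmap_cdiff_inj => //; first by rewrite hL hn.
by rewrite -hKcard subfield_expf_card.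
Qed.
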